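(* Let $A \in \mathbb{R}^{m\times n}$ have rows $\mathbf{a}_1^\top,\dots,\mathbf{a}_m^\top$. Suppose the system $A\mathbf{x}=\mathbf{b}$ is consistent, let $\mathbf{x}^* = A^\dagger \mathbf{b}$, and let $\mathbf{x}_0 \in \mathrm{range}(A^\top)$. Let $\mathbf{x}_1,\mathbf{x}_2,\dots$ be the iterates of the generalized SKM method with sample sizes $\beta_1,\beta_2,\dots\in\{1,\dots,m\}$ started at $\mathbf{x}_0$. Then in the $k$th iteration (with $\mathbf{x}_{k-1}\neq\mathbf{x}^*$), $$\mathbb{E}_{\tau_k} \|\mathbf{x}_k - \mathbf{x}^*\|^2 \le \left(1 - \frac{\beta_k\binom{m}{\beta_k} \sigma_{\min}^2(A)}{\gamma_k\, m \sum_{\tau \in \binom{[m]}{\beta_k}}\|\mathbf{a}_{t(\tau,\mathbf{x}_{k-1})}\|^2}\right) \|\mathbf{x}_{k-1} - \mathbf{x}^*\|^2 .$$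
   Context: Standing assumption: $m>n$; no assumption is made on $\mathrm{rank}(A)$. $\|\cdot\|$ is the Euclidean norm, $\|\cdot\|_\infty$ the $\ell^\infty$ norm, $A^\dagger$ the Moore-Penrose pseudoinverse, and $\sigma_{\min}(A)$ the smallest nonzero singular value of $A$. $[m]=\{1,\dots,m\}$ and $\binom{[m]}{\beta}$ is the set of subsets of $[m]$ of size $\beta$. For $\tau\subseteq[m]$, $A_\tau$ and $\mathbf{b}_\tau$ are the restrictions of $A$ and $\mathbf{b}$ to the rows indexed by $\tau$. For $\tau\subseteq[m]$ nonempty and $\mathbf{x}\in\mathbb{R}^n$, let $t(\tau,\mathbf{x}) = \arg\max_{t\in\tau}(\mathbf{a}_t^\top\mathbf{x}-b_t)^2$ (an arbitrary fixed choice among maximizers). Generalized SKM: in iteration $k\ge1$, sample $\tau_k\in\binom{[m]}{\beta_k}$ from the distribution $p_{\mathbf{x}_{k-1}}$, where $$p_{\mathbf{x}}(\tau) = \frac{\|\mathbf{a}_{t(\tau,\mathbf{x})}\|^2}{\sum_{\pi \in \binom{[m]}{\beta_k}} \|\mathbf{a}_{t(\pi,\mathbf{x})}\|^2},$$ put $t_k = t(\tau_k,\mathbf{x}_{k-1})$, and set $$\mathbf{x}_k = \mathbf{x}_{k-1} - \frac{\mathbf{a}_{t_k}^\top \mathbf{x}_{k-1} - b_{t_k}}{\|\mathbf{a}_{t_k}\|^2}\,\mathbf{a}_{t_k}.$$ (Sets $\tau$ whose selected row is zero have probability $0$.) Dynamic range: $$\gamma_k = \frac{\sum_{\tau \in \binom{[m]}{\beta_k}}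 \|A_{\tau}\mathbf{x}_{k-1} - \mathbf{b}_{\tau}\|^2}{\sum_{\tau \in \binom{[m]}{\beta_k}} \|A_{\tau}\mathbf{x}_{k-1} - \mathbf{b}_{\tau}\|_\infty^2},$$ which is defined when $A\mathbf{x}_{k-1}\neq\mathbf{b}$. $\mathbb{E}_{\tau_k}$ is expectation with respect to the random sample $\tau_k$, conditioned on the previously sampled $\tau_i$, $i<k$ (so $\mathbf{x}_{k-1}$ is fixed). *)

(* Defs.v *)
From mathcomp Require Import all_boot all_order all_algebra.
From mathcomp Require Import all_classical all_reals all_analysis.
Set Implicit Arguments.
Unset Strict Implicit.
Unset Printing Implicit Defensive.
Import Order.TTheory GRing.Theory Num.Theory.
Import numFieldNormedType.Exports.
Local Open Scope ring_scope.

(* The Euclidean norm.  The library norm `|v| on matrices is the entrywise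
   maximum of the absolute values, i.e. the l^oo norm on column vectors. *)
Definition norm2 {R : realType} {p : nat} (v : 'cV[R]_p) : R :=
  Num.sqrt (\sum_(i < p) v i 0 ^+ 2).

(* The four Penrose conditions; exactly one X satisfies them. *)
Definition is_moore_penrose {R : realType} {m n : nat}
    (A : 'M[R]_(m, n)) (X : 'M[R]_(n, m)) : Prop :=
  [/\ A *m X *m A = A, X *m A *m X = X,
      (A *m X)^T = A *m X & (X *m A)^T = X *m A].

Definition moore_penrose {R : realType} {m n : nat} (A : 'M[R]_(m, n)) : 'M[R]_(n, m) :=
  xget 0 [set X | is_moore_penrose A X]%classic.

Definition singular_value {R : realType} {m n : nat}
    (A : 'M[R]_(m, n)) (s : R) : Prop :=
  0 <= s /\ eigenvalue (A^T *m A) (s ^+ 2).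

(* The smallest nonzero singular value; it exists whenever A != 0, and the
   default value 0 is taken only for A = 0. *)
Definition sigma_min {R : realType} {m n : nat} (A : 'M[R]_(m, n)) : R :=
  xget 0 [set s | [/\ singular_value A s, s != 0 &
    forall s', singular_value A s' -> s' != 0 -> s <= s']]%classic.

Definition rows_of {R : realType} {m p : nat} (tau : {set 'I_m})
    (B : 'M[R]_(m, p)) : 'M[R]_(#|tau|, p) :=
  rowsub (fun i : 'I_#|tau| => enum_val i) B.

(* The vector a_t, as a column: row t A is a_t^T. *)
Definition arow {R : realType} {m n : nat} (A : 'M[R]_(m, n)) (t : 'I_m)
  : 'cV[R]_n := (row t A)^T.

Definition residual {R : realType} {m n : nat} (A : 'M[R]_(m, n))
    (b : 'cV[R]_m) (x : 'cV[R]_n) (t : 'I_m) : R :=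
  ((arow A t)^T *m x) 0 0 - b t 0.

(* sel is a choice, for every nonempty tau and every x, of a maximizer of the
   squared residual over tau; its values at tau = set0 are irrelevant. *)
Definition is_selection {R : realType} {m n : nat} (A : 'M[R]_(m, n))
    (b : 'cV[R]_m) (sel : {set 'I_m} -> 'cV[R]_n -> 'I_m) : Prop :=
  forall (tau : {set 'I_m}) (x : 'cV[R]_n), tau != finset.set0 ->
    sel tau x \in tau /\
    forall s : 'I_m, s \in tau ->
      residual A b x s ^+ 2 <= residual A b x (sel tau x) ^+ 2.

Section GeneralizedSKM.
Context {R : realType} {m n : nat}.
Variables (A : 'M[R]_(m, n)) (b : 'cV[R]_m).
Variable sel : {set 'I_m} -> 'cV[R]_n -> 'I_m.

Definition skm_weight (beta : nat) (x : 'cV[R]_n) : R :=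
  \sum_(pi : {set 'I_m} | #|pi| == beta) norm2 (arow A (sel pi x)) ^+ 2.

Definition skm_prob (beta : nat) (x : 'cV[R]_n) (tau : {set 'I_m}) : R :=
  norm2 (arow A (sel tau x)) ^+ 2 / skm_weight beta x.

Definition skm_expectation (beta : nat) (x : 'cV[R]_n)
    (f : {set 'I_m} -> R) : R :=
  \sum_(tau : {set 'I_m} | #|tau| == beta) skm_prob beta x tau * f tau.

Definition skm_step (x : 'cV[R]_n) (tau : {set 'I_m}) : 'cV[R]_n :=
  let t := sel tau x in
  x - (residual A b x t / norm2 (arow A t) ^+ 2) *: arow A t.

(* The iterate x_k along the realized samples tau 1, ..., tau k
   (tau 0 is never used). *)
Fixpoint skm_iter (x0 : 'cV[R]_n) (tau : nat -> {set 'I_m}) (k : nat)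
  : 'cV[R]_n :=
  if k is k'.+1 then skm_step (skm_iter x0 tau k') (tau k) else x0.

(* tau 1, ..., tau k.-1 is a possible outcome of the sampling that precedes
   iteration k: each sample has the prescribed size and positive probability
   given the earlier ones. *)
Definition skm_history (beta : nat -> nat) (x0 : 'cV[R]_n)
    (tau : nat -> {set 'I_m}) (k : nat) : Prop :=
  forall i : nat, (0 < i < k)%N ->
    #|tau i| = beta i /\
    0 < skm_prob (beta i) (skm_iter x0 tau i.-1) (tau i).

Definition dynamic_range (beta : nat) (x : 'cV[R]_n) : R :=
  (\sum_(tau : {set 'I_m} | #|tau| == beta)
     norm2 (rows_of tau A *m x - rows_of tau b) ^+ 2)
  / (\sum_(tau : {set 'I_m} | #|tau| == beta)
     `|rows_of tau A *m x - rows_of tau b| ^+ 2).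

End GeneralizedSKM.

(* Main.v *)
(* Write e = x_{k-1} - x^*, r = A x_{k-1} - b = A e and S for the sum of the
   squared norms of the selected rows.  Projecting onto the hyperplane of row t
   lowers |e|^2 by r_t^2 / |a_t|^2, and the sampling weights cancel the
   denominators, so the expectation is exactly |e|^2 - D / S, where D is the sum
   of the |r_tau|_oo^2.  Double counting gives
   m * (sum of the |r_tau|^2) = beta * C(m, beta) * |A e|^2, so the subtracted
   term of the bound is (sigma_min^2 |e|^2 / |A e|^2) * D / S, which is at most
   D / S because e stays in the range of A^T. *)
Require Import Defs.
From mathcomp Require Import all_boot all_order all_algebra.
From mathcomp Require Import all_classical all_reals all_analysis.
From mathcomp Require Import ring lra.
Import Order.TTheory GRing.Theory Num.Theory.
Import numFieldNormedType.Exports.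
Local Open Scope ring_scope.

(** * Euclidean norm, Gram matrices and the pseudoinverse *)

Lemma norm2_sqr {R : realType} {p : nat} (v : 'cV[R]_p) :
  norm2 v ^+ 2 = (v^T *m v) 0 0.
Proof.
rewrite sqr_sqrtr; last by apply: sumr_ge0 => i _; exact: sqr_ge0.
by rewrite mxE; apply: eq_bigr => i _; rewrite !mxE.
Qed.

Lemma norm2_sqr_eq0 {R : realType} {p : nat} (v : 'cV[R]_p) :
  (norm2 v ^+ 2 == 0) = (v == 0).
Proof.
apply/eqP/eqP => [|->]; last by rewrite norm2_sqr mulmx0 mxE.
rewrite sqr_sqrtr; last by apply: sumr_ge0 => i _; exact: sqr_ge0.
move=> v0; apply/colP => i; rewrite mxE; apply/eqP; rewrite -sqrf_eq0.
by rewrite (psumr_eq0P _ v0) // => j _; exact: sqr_ge0.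
Qed.

(** The quadratic form is the squared Euclidean norm of [(u *m A)^T]. *)
Lemma mulmx_tr_eq0 {R : realType} {p q : nat} (A : 'M[R]_(p, q)) (u : 'rV[R]_p) :
  u *m (A *m A^T) *m u^T = 0 -> u *m A = 0.
Proof.
move=> u0; have: norm2 (u *m A)^T ^+ 2 = 0.
  by rewrite norm2_sqr trmxK trmx_mul !mulmxA -(mulmxA u) u0 mxE.
by move/eqP; rewrite norm2_sqr_eq0 => /eqP/(congr1 trmx); rewrite trmxK trmx0.
Qed.

Lemma row_free_mulmx_tr_unit {R : realType} {p q : nat} (F : 'M[R]_(p, q)) :
  row_free F -> F *m F^T \in unitmx.
Proof.
move=> freeF; rewrite -row_free_unit; apply: inj_row_free => u u0.
apply/eqP; rewrite -(mulmx_free_eq0 _ freeF); apply/eqP/mulmx_tr_eq0.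
by rewrite u0 mul0mx.
Qed.

(* With A = C F a full rank factorization, the pseudoinverse is
   F^T (F F^T)^-1 (C^T C)^-1 C^T. *)
Lemma moore_penrose_exists {R : realType} {m n : nat} (A : 'M[R]_(m, n)) :
  exists X, is_moore_penrose A X.
Proof.
have [r [C [F [AE uC uF]]]] : exists r (C : 'M[R]_(m, r)) (F : 'M[R]_(r, n)),
    [/\ A = C *m F, C^T *m C \in unitmx & F *m F^T \in unitmx].
  exists (\rank A), (col_base A), (row_base A); split.
  - by rewrite mulmx_base.
  - rewrite -{2}[col_base A]trmxK; apply: row_free_mulmx_tr_unit.
    by rewrite /row_free mxrank_tr; exact: col_base_full.
  - exact/row_free_mulmx_tr_unit/row_base_free.
exists (F^T *m invmx (F *m F^T) *m invmx (C^T *m C) *m C^T).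
have AX : A *m (F^T *m invmx (F *m F^T) *m invmx (C^T *m C) *m C^T)
    = C *m invmx (C^T *m C) *m C^T.
  by rewrite AE !mulmxA -(mulmxA C F) mulmxK.
have XA : (F^T *m invmx (F *m F^T) *m invmx (C^T *m C) *m C^T) *m A
    = F^T *m invmx (F *m F^T) *m F.
  by rewrite AE !mulmxA -(mulmxA _ C^T C) mulmxKV.
split.
- by rewrite AX AE !mulmxA -(mulmxA _ C^T C) mulmxKV.
- by rewrite XA !mulmxA -(mulmxA _ F) mulmxKV.
- by rewrite AX !trmx_mul trmxK trmx_inv trmx_mul trmxK mulmxA.
- by rewrite XA !trmx_mul trmxK trmx_inv trmx_mul trmxK mulmxA.
Qed.

(** Existence ensures that [xget] does not fall back on its default value. *)
Lemma moore_penroseP {R : realType} {m n : nat} (A : 'M[R]_(m, n)) :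
  is_moore_penrose A (moore_penrose A).
Proof. exact: (xgetPex 0 (moore_penrose_exists A)). Qed.

(** * The smallest nonzero singular value and the Rayleigh quotient *)

Lemma quadratic_form_continuous {R : realType} {n : nat} (B : 'M[R]_n) :
  continuous (fun v : 'rV[R]_n => (v *m B *m v^T) 0 0).
Proof.
have -> : (fun v : 'rV[R]_n => (v *m B *m v^T) 0 0)
    = (fun v => \sum_i \sum_j v 0 j * B j i * v 0 i).
  apply/funext => v; rewrite mxE; apply: eq_bigr => i _.
  by rewrite !mxE mulr_suml.
apply: continuous_big => [|i _]; first exact: add_continuous.
apply: continuous_big => [|j _ v]; first exact: add_continuous.
have coord l : ((w : 'rV[R]_n) 0 l @[w --> v] --> v 0 l)%classic.
  exact: coord_continuous.
exact: cvgM (cvgM (coord j) (cvg_cst _)) (coord i).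
Qed.

Lemma unit_row_space_compact {R : realType} {m n : nat} (A : 'M[R]_(m, n)) :
  compact [set v : 'rV[R]_n | (v *m v^T) 0 0 = 1 /\ (v <= A)%MS]%classic.
Proof.
pose q (B : 'M[R]_n) (v : 'rV[R]_n) := (v *m B *m v^T) 0 0.
apply: bounded_closed_compact.
  exists 1; split => // M M1 v [v1 _] /=; rewrite [`|v|]mx_normrE.
  apply: bigmax_le => [|[i j] _ /=]; first by apply: le_trans (ltW M1).
  apply: le_trans (ltW M1); rewrite -(@expr_le1 _ 2) // -v1 ord1 mxE.
  rewrite (bigD1 j) //= !mxE real_normK ?num_real // -expr2 lerDl.
  by apply: sumr_ge0 => l _; rewrite !mxE -expr2 sqr_ge0.
(* Membership in the row space means [v *m C = 0], that is, the form of [C *m C^T] vanishes at [v].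
   Both constraints thus become level sets of continuous quadratic forms. *)
pose C := cokermx A.
have -> : [set v : 'rV[R]_n | (v *m v^T) 0 0 = 1 /\ (v <= A)%MS]%classic
    = (q 1%:M @^-1` [set 1] `&` q (C *m C^T) @^-1` [set 0])%classic.
  apply/seteqP; split => v /= [v1 vA]; split; rewrite ?/q ?mulmx1 //.
  - by move: vA; rewrite submxE => /eqP vC; rewrite mulmxA vC !mul0mx mxE.
  - by move: v1; rewrite /q mulmx1.
  - rewrite submxE; apply/eqP/mulmx_tr_eq0.
    by apply/matrixP => i j; rewrite !ord1 [RHS]mxE.
by apply: closedI; apply: closed_comp; do ?exact: closed_eq;
  move=> v _; exact: quadratic_form_continuous.
Qed.

(* The minimum of the Rayleigh quotient of A^T A over the row space of A is an
   eigenvalue: if mu is attained at v0, then B := A^T A - mu is nonnegative on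
   the row space, and vanishing of its first variation at v0 in the direction
   v0 B forces v0 B = 0. *)
Lemma rayleigh_min_eigenvalue {R : realType} {m n : nat} (A : 'M[R]_(m, n))
    (w : 'rV[R]_n) :
  w != 0 -> (w <= A)%MS ->
  exists mu, [/\ 0 < mu, eigenvalue (A^T *m A) mu &
    forall v : 'rV[R]_n, (v <= A)%MS ->
      mu * (v *m v^T) 0 0 <= (v *m (A^T *m A) *m v^T) 0 0].
Proof.
have nrm (v : 'rV[R]_n) : (v *m v^T) 0 0 = norm2 v^T ^+ 2.
  by rewrite norm2_sqr trmxK.
have nrm_gt0 (v : 'rV[R]_n) : v != 0 -> 0 < (v *m v^T) 0 0.
  rewrite nrm lt_def sqr_ge0 andbT norm2_sqr_eq0.
  by apply: contra => /eqP /(congr1 trmx); rewrite trmxK trmx0 => ->.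
set M := A^T *m A; pose q (v : 'rV[R]_n) := (v *m M *m v^T) 0 0.
pose K := [set v : 'rV[R]_n | (v *m v^T) 0 0 = 1 /\ (v <= A)%MS]%classic.
have scaleK (v : 'rV[R]_n) : v != 0 -> (v <= A)%MS -> K ((norm2 v^T)^-1 *: v).
  move=> v0 vA; split; last exact: scalemx_sub.
  rewrite linearZ /= -scalemxAl -scalemxAr scalerA mxE nrm -expr2 exprVn mulVf //.
  by rewrite -nrm gt_eqF // nrm_gt0.
move=> w0 wA.
have [v0] := compact_EVT_min (ex_intro _ _ (scaleK w w0 wA))
  (unit_row_space_compact A)
  (continuous_subspaceT (@quadratic_form_continuous R n M)).
rewrite inE => -[v01 v0A] v0min; exists (q v0).
have v0n0 : v0 != 0.
  by apply/eqP => v00; move: v01; rewrite v00 mul0mx mxE => /eqP; rewrite eq_sym oner_eq0.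
(* By homogeneity the minimum on the unit sphere bounds the form on the whole row space. *)
have qmin (v : 'rV[R]_n) : (v <= A)%MS -> q v0 * (v *m v^T) 0 0 <= q v.
  move=> vA; have [->|vn0] := eqVneq v 0.
    by rewrite {2}/q !mul0mx [X in _ * X]mxE mulr0 mxE.
  have := v0min _ (mem_set (scaleK _ vn0 vA)).
  rewrite -/(q v0) linearZ /= -!scalemxAl -scalemxAr scalerA mxE -/(q v).
  by rewrite -expr2 exprVn mulrC ler_pdivlMr -nrm ?nrm_gt0.
have MT : M^T = M by rewrite trmx_mul trmxK.
have qE (v : 'rV[R]_n) : q v = norm2 (A *m v^T) ^+ 2.
  by rewrite norm2_sqr trmx_mul trmxK /q !mulmxA.
split=> //.
  (* The minimum is positive: if [A *m v0^T = 0], writing [v0 = D *m A] gives [v0 *m v0^T = 0],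
     although [v0] is a unit vector. *)
  rewrite qE lt_def sqr_ge0 andbT norm2_sqr_eq0; apply/eqP => Av.
  have /submxP[D v0E] := v0A; move: v01.
  rewrite {1}v0E -mulmxA Av mulmx0 mxE => /eqP.
  by rewrite eq_sym oner_eq0.
pose B := M - (q v0)%:M.
have qB (v : 'rV[R]_n) : (v *m B *m v^T) 0 0 = q v - q v0 * (v *m v^T) 0 0.
  by rewrite /B mulmxBr mulmxBl mul_mx_scalar -scalemxAl mxE [X in _ + X]mxE [X in _ - X]mxE.
apply/eigenvalueP; exists v0 => //; apply/eqP.
rewrite -subr_eq0 -mul_mx_scalar -mulmxBr -/B; apply/eqP.
set u := v0 *m B.
(* The direction [u] stays in the row space, so [v0 + t *: u] is an admissible variation for every
   [t]. *)
have uA : (u <= A)%MS.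
  rewrite /u /B mulmxBr mul_mx_scalar addmx_sub ?eqmx_opp ?scalemx_sub //.
  by rewrite mulmxA submxMl.
apply/eqP/negPn/negP => /nrm_gt0; set c := (u *m u^T) 0 0 => c_gt0.
pose d := (u *m B *m u^T) 0 0.
have d_ge0 : 0 <= d by rewrite /d qB subr_ge0 qmin.
have BT : B^T = B by rewrite /B linearB /= MT tr_scalar_mx.
clearbody B.
(* Expansion of the form of [B] at [v0 + t *: u]: the constant term is zero by the definition of
   [B], and both cross terms equal [c] by symmetry. *)
have var t : 0 <= 2 * t * c + t ^+ 2 * d.
  have : 0 <= ((v0 + t *: u) *m B *m (v0 + t *: u)^T) 0 0.
    by rewrite qB subr_ge0 qmin // addmx_sub // scalemx_sub.
  have uBv0 : u *m B *m v0^T = u *m u^T.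
    by rewrite [in RHS]/u trmx_mul BT mulmxA.
  have -> : (v0 + t *: u)^T = v0^T + t *: u^T by rewrite linearD linearZ.
  rewrite mulmxDl -/u mulmxDl !mulmxDr -!scalemxAl -!scalemxAr.
  have addE (X Y : 'M[R]_1) : (X + Y) 0 0 = X 0 0 + Y 0 0 by rewrite mxE.
  have scaleE a (X : 'M[R]_1) : (a *: X) 0 0 = a * X 0 0 by rewrite mxE.
  rewrite uBv0 !(addE, scaleE) {1}/u qB v01 mulr1 subrr add0r -/c -/d.
  by congr (0 <= _); ring.
(* The choice [t = - c / (d + 1)] makes the quadratic negative; the added 1 keeps the denominator
   positive even when [d = 0]. *)
have d1 : 0 < d + 1 by lra.
have := var (- c / (d + 1)).
have -> : 2 * (- c / (d + 1)) * c + (- c / (d + 1)) ^+ 2 * d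
   = - (c ^+ 2 * (d + 2) / (d + 1) ^+ 2) by field; rewrite gt_eqF.
rewrite oppr_ge0 leNgt divr_gt0 ?mulr_gt0 ?exprn_gt0 //; lra.
Qed.

(** Vectors of the form [A^T *m y] are transposes of row space vectors, so the Rayleigh minimum [mu]
    applies. Being a positive eigenvalue of [A^T *m A], it makes [Num.sqrt mu] a nonzero singular
    value, whence [sigma_min A ^+ 2 <= mu]. *)
Lemma sigma_min_mul_le {R : realType} {m n : nat} (A : 'M[R]_(m, n))
    (y : 'cV[R]_m) :
  sigma_min A ^+ 2 * norm2 (A^T *m y) ^+ 2 <= norm2 (A *m (A^T *m y)) ^+ 2.
Proof.
set e := A^T *m y; have [->|e0] := eqVneq e 0.
  by rewrite (eqP (_ : norm2 0 ^+ 2 == 0)) ?norm2_sqr_eq0 // mulr0 sqr_ge0.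
have eA : (e^T <= A)%MS by rewrite trmx_mul trmxK submxMl.
have [|mu [mu0 muE muP]] := rayleigh_min_eigenvalue A e^T _ eA.
  by apply: contra e0 => /eqP/(congr1 trmx); rewrite trmxK trmx0 => ->.
have := muP _ eA; rewrite trmxK mulmxA -norm2_sqr -mulmxA -{2}[A]trmxK -trmx_mul.
rewrite trmxK -norm2_sqr => {}muP; apply: le_trans muP.
rewrite ler_wpM2r ?sqr_ge0 // /sigma_min.
(* In the default branch [sigma_min A] is 0 and the bound is just [0 <= mu]. *)
case: xgetP => [s _ [[s0 _] _ smin]|_]; last by rewrite expr0n ltW.
rewrite -[leRHS]sqr_sqrtr ?(ltW mu0) // lerXn2r ?nnegrE ?sqrtr_ge0 //.
apply: smin; last by rewrite sqrtr_eq0 -ltNge.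
by split; rewrite ?sqrtr_ge0 // sqr_sqrtr // ltW.
Qed.

(** * Double counting over subsets of fixed size *)

(** Removing the sets that avoid [i] from all draws leaves, by Pascal's rule, ['C(#|T|.-1, k.-1)]
    sets; the absorption identity for binomials then gives the product form, free of
    predecessors. *)
Lemma card_draws_mem {T : finType} (i : T) (k : nat) : (0 < k)%N ->
  (#|T| * #|[set B : {set T} | (#|B| == k) && (i \in B)]| = k * 'C(#|T|, k))%N.
Proof.
case: k => // k _; rewrite -mul_bin_diag; congr (_ * _)%N.
have := card_draws T k.+1.
rewrite -(cardsID [set B : {set T} | i \in B]).
have -> : [set B : {set T} | #|B| == k.+1] :\: [set B : {set T} | i \in B]
    = [set B : {set T} | B \subset [set~ i] & #|B| == k.+1].
  by apply/setP => B; rewrite !inE finset.subsetC finset.sub1set inE.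
rewrite cards_draws cardsC1.
have /prednK <- : (0 < #|T|)%N by apply/card_gt0P; exists i.
rewrite binS addnC => /addnI <-.
by apply: eq_card => B; rewrite !inE.
Qed.

Lemma sum_draws {R : realType} {T : finType} (k : nat) (c : T -> R) :
  (0 < k)%N ->
  #|T|%:R * \sum_(B : {set T} | #|B| == k) \sum_(i in B) c i
    = (k * 'C(#|T|, k))%:R * \sum_i c i.
Proof.
move=> k0; rewrite (exchange_big_dep predT) //= !mulr_sumr.
apply: eq_bigr => i _; rewrite sumr_const -(card_draws_mem i k k0) natrM -mulrA.
congr (_ * _); rewrite mulr_natl; congr (_ *+ _).
by apply: eq_card => B; rewrite !inE.
Qed.

(** * One step of the method, for a fixed sample *)

Section Iteration.
Context {R : realType} {m n : nat}.
Variables (A : 'M[R]_(m, n)) (b : 'cV[R]_m).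
Variable sel : {set 'I_m} -> 'cV[R]_n -> 'I_m.

Lemma residualE x t : residual A b x t = (A *m x - b) t 0.
Proof. by rewrite /residual /arow trmxK -row_mul !mxE. Qed.

Lemma arow_range (t : 'I_m) : arow A t = A^T *m delta_mx t 0.
Proof. by rewrite /arow rowE trmx_mul trmx_delta. Qed.

(** Each step subtracts a multiple of a row of [A]. Together with [moore_penrose_range], this puts
    the error in the range of [A^T]. *)
Lemma skm_iter_range x0 tau k : (exists y, x0 = A^T *m y) ->
  exists y, skm_iter A b sel x0 tau k = A^T *m y.
Proof.
move=> x0A; elim: k => //= k [y ->].
rewrite /skm_step arow_range; set a := _ / _; set d := delta_mx _ _.
by exists (y - a *: d); rewrite mulmxBr -scalemxAr.
Qed.

(** With [X] the pseudoinverse, [X = X *m A *m X] and the symmetry of [X *m A] give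
    [X = A^T *m X^T *m X]. *)
Lemma moore_penrose_range : exists y, moore_penrose A *m b = A^T *m y.
Proof.
have [_ XAX _ XAT] := moore_penroseP A; set X := moore_penrose A in XAX XAT *.
by exists (X^T *m (X *m b)); rewrite -{1}XAX -XAT trmx_mul -!mulmxA.
Qed.

Lemma moore_penrose_solves : (exists x, A *m x = b) ->
  A *m (moore_penrose A *m b) = b.
Proof.
by case=> x <-; have [AXA _ _ _] := moore_penroseP A; rewrite !mulmxA AXA.
Qed.

Lemma norm2_rows_of tau x :
  norm2 (rows_of tau A *m x - rows_of tau b) ^+ 2
    = \sum_(t in tau) residual A b x t ^+ 2.
Proof.
rewrite /rows_of mul_rowsub_mx sqr_sqrtr; last by apply: sumr_ge0 => i _; exact: sqr_ge0.
by rewrite [RHS]big_enum_val; apply: eq_bigr => i _; rewrite residualE !mxE.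
Qed.

Lemma norm_rows_of tau x : is_selection A b sel -> tau != finset.set0 ->
  `|rows_of tau A *m x - rows_of tau b| ^+ 2 = residual A b x (sel tau x) ^+ 2.
Proof.
move=> hsel /(hsel tau x)[selin selmax].
rewrite -[RHS]real_normK ?num_real //; congr (_ ^+ 2).
rewrite [LHS]mx_normrE; apply/eqP; rewrite eq_le; apply/andP; split.
  apply: bigmax_le => // -[i j] _ /=; rewrite ord1 /rows_of mul_rowsub_mx.
  rewrite -ler_sqr ?nnegrE // !real_normK ?num_real //.
  by have := selmax _ (enum_valP i); rewrite [leLHS]/= residualE !mxE.
apply: le_trans (le_bigmax _ _ (enum_rank_in selin (sel tau x), 0)) => /=.
by rewrite residualE /rows_of mul_rowsub_mx !mxE enum_rankK_in.
Qed.

(** Pythagoras for the projection onto the hyperplane of the selected row, multiplied through by the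
    squared row norm. In this form it also covers a zero row, whose residual vanishes by
    consistency. *)
Lemma norm2_skm_step xs x tau : A *m xs = b ->
  norm2 (arow A (sel tau x)) ^+ 2 * norm2 (skm_step A b sel x tau - xs) ^+ 2
    = norm2 (arow A (sel tau x)) ^+ 2 * norm2 (x - xs) ^+ 2
      - residual A b x (sel tau x) ^+ 2.
Proof.
move=> Axs; rewrite /skm_step; set t := sel tau x; set a := arow A t.
set r := residual A b x t; set e := x - xs.
have rE : r = (a^T *m e) 0 0.
  by rewrite /r residualE -Axs -mulmxBr /a /arow trmxK -row_mul [RHS]mxE.
clearbody a; have [a0|a0] := eqVneq a 0.
  rewrite rE a0 trmx0 mul0mx mxE expr0n subr0.
  by rewrite (eqP (_ : norm2 0 ^+ 2 == 0)) ?norm2_sqr_eq0 // !mul0r.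
have N0 : norm2 a ^+ 2 != 0 by rewrite norm2_sqr_eq0.
set c := r / _; have -> : x - c *: a - xs = e - c *: a by rewrite addrAC.
clearbody e; have -> : norm2 (e - c *: a) ^+ 2
    = norm2 e ^+ 2 - 2 * c * r + c ^+ 2 * norm2 a ^+ 2.
  have subE (X Y : 'M[R]_1) : (X - Y) 0 0 = X 0 0 - Y 0 0 by rewrite !mxE.
  have scaleE k (X : 'M[R]_1) : (k *: X) 0 0 = k * X 0 0 by rewrite mxE.
  have er : (e^T *m a) 0 0 = r by rewrite rE -[in RHS](trmxK e) -trmx_mul [RHS]mxE.
  have -> : norm2 (e - c *: a) ^+ 2 =
      ((e^T - c *: a^T) *m (e - c *: a)) 0 0.
    by rewrite norm2_sqr; congr ((_ *m _) 0 0); rewrite linearB linearZ.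
  rewrite mulmxBl !mulmxBr -!scalemxAl -!scalemxAr !(subE, scaleE) -!norm2_sqr.
  by rewrite er -rE; ring.
by rewrite /c; field; rewrite -sqrf_eq0.
Qed.

End Iteration.

(** * The expected error and the contraction bound *)

Lemma skm_expectation_step {R : realType} {m n : nat}
    (A : 'M[R]_(m, n)) (b : 'cV[R]_m) (sel : {set 'I_m} -> 'cV[R]_n -> 'I_m)
    (xs x : 'cV[R]_n) (k : nat) :
  A *m xs = b -> skm_weight A sel k x != 0 ->
  skm_expectation A sel k x
    (fun tau => norm2 (skm_step A b sel x tau - xs) ^+ 2)
  = norm2 (x - xs) ^+ 2
    - (\sum_(tau : {set 'I_m} | #|tau| == k) residual A b x (sel tau x) ^+ 2)
      / skm_weight A sel k x.
Proof.
move=> Axs S0; apply: (mulIf S0).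
rewrite mulrBl divfK // [X in _ = X - _]mulrC /skm_expectation !mulr_suml -sumrB.
apply: eq_bigr => tau _; rewrite -(norm2_skm_step A b sel xs x tau Axs).
by rewrite /skm_prob mulrAC divfK.
Qed.

Theorem theorem1 (R : realType) (m n : nat) (hmn : (n < m)%N)
  (A : 'M[R]_(m, n)) (b : 'cV[R]_m)
  (hcons : exists x : 'cV[R]_n, A *m x = b)
  (x0 : 'cV[R]_n) (hx0 : exists y : 'cV[R]_m, x0 = A^T *m y)
  (sel : {set 'I_m} -> 'cV[R]_n -> 'I_m) (hsel : is_selection A b sel)
  (beta : nat -> nat) (hbeta : forall i : nat, (0 < i)%N -> (1 <= beta i <= m)%N)
  (k : nat) (hk : (0 < k)%N)
  (tau : nat -> {set 'I_m}) (htau : skm_history A b sel beta x0 tau k)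
  (xstar := moore_penrose A *m b)
  (xprev := skm_iter A b sel x0 tau k.-1)
  (hne : xprev <> xstar) :
  skm_expectation A sel (beta k) xprev
    (fun tauk : {set 'I_m} => norm2 (skm_step A b sel xprev tauk - xstar) ^+ 2)
  <= (1 - (beta k)%:R * 'C(m, beta k)%:R * sigma_min A ^+ 2
          / (dynamic_range A b (beta k) xprev * m%:R
             * \sum_(pi : {set 'I_m} | #|pi| == beta k)
                 norm2 (arow A (sel pi xprev)) ^+ 2))
     * norm2 (xprev - xstar) ^+ 2.
Proof.
have Axs : A *m xstar = b by exact: moore_penrose_solves.
have [y eE] : exists y, xprev - xstar = A^T *m y.
  have [y1 x1] := skm_iter_range A b sel x0 tau k.-1 hx0.
  have [y2 x2] := moore_penrose_range A b.
  by exists (y1 - y2); rewrite mulmxBr -x1 -x2.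
have /andP[beta_gt0 beta_le] := hbeta k hk.
clearbody xprev xstar; set x := xprev in hne eE *; set e := x - xstar in eE *.
have e0 : e != 0 by rewrite subr_eq0; exact/eqP.
set q := beta k in beta_gt0 beta_le *.
rewrite -/(skm_weight A sel q x); set S := skm_weight A sel q x.
set sig := sigma_min A; set g := norm2 (A *m e) ^+ 2.
have sig_le : sig ^+ 2 * norm2 e ^+ 2 <= g by rewrite /g eE sigma_min_mul_le.
(* The kernel of [A] meets the range of [A^T] only in 0: if [A *m e = 0] and [e = A^T *m y], then
   [e^T *m e = y^T *m (A *m e) = 0]. *)
have g_gt0 : 0 < g.
  rewrite lt_def sqr_ge0 andbT norm2_sqr_eq0; apply: contra e0 => /eqP Ae0.
  by rewrite -norm2_sqr_eq0 norm2_sqr {1}eE trmx_mul trmxK -mulmxA Ae0 mulmx0 mxE.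
have draw_neq0 (B : {set 'I_m}) : #|B| == q -> B != finset.set0.
  by move=> /eqP Bq; rewrite -card_gt0 Bq.
pose D := \sum_(B : {set 'I_m} | #|B| == q) residual A b x (sel B x) ^+ 2.
pose N := \sum_(B : {set 'I_m} | #|B| == q) \sum_(t in B) residual A b x t ^+ 2.
have gammaE : dynamic_range A b q x = N / D.
  rewrite /dynamic_range; congr (_ / _); apply: eq_bigr => B Bq.
    exact: norm2_rows_of.
  exact: norm_rows_of (draw_neq0 B Bq).
have NE : m%:R * N = q%:R * 'C(m, q)%:R * g.
  have /= := sum_draws q (fun t => residual A b x t ^+ 2) beta_gt0.
  rewrite card_ord natrM => ->; congr (_ * _).
  rewrite /g sqr_sqrtr; last by apply: sumr_ge0 => i _; exact: sqr_ge0.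
  by apply: eq_bigr => t _; rewrite residualE -Axs -mulmxBr.
have m_gt0 : 0 < m%:R :> R by rewrite ltr0n (leq_trans beta_gt0).
have qC_gt0 : 0 < q%:R * 'C(m, q)%:R :> R.
  by rewrite mulr_gt0 ?ltr0n ?bin_gt0.
have N_gt0 : 0 < N by rewrite -(pmulr_rgt0 _ m_gt0) NE mulr_gt0.
have D_ge0 : 0 <= D by apply: sumr_ge0 => B _; exact: sqr_ge0.
(* If [D] were 0, every selected residual would vanish; these are maximal on their sets, so [N]
   would be 0 too. *)
have D_gt0 : 0 < D.
  rewrite lt_def D_ge0 andbT; apply: contraTneq N_gt0 => D0.
  rewrite -leNgt [N]big1 // => B Bq; apply: big1 => t tB; apply/eqP.
  have [_ /(_ t tB)] := hsel B x (draw_neq0 B Bq).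
  rewrite (psumr_eq0P _ D0) // => [h|C _]; last exact: sqr_ge0.
  by rewrite eq_le h sqr_ge0.
(* If [S] were 0, every selected row would be zero, and [norm2_skm_step] would force every selected
   residual, hence [D], to vanish. *)
have S_gt0 : 0 < S.
  rewrite lt_def sumr_ge0 ?andbT => [|B _]; last exact: sqr_ge0.
  apply: contraTneq D_gt0 => S0; rewrite -leNgt [D]big1 // => B Bq.
  have := norm2_skm_step A b sel xstar x B Axs.
  rewrite (psumr_eq0P _ S0) // => [|C _]; last exact: sqr_ge0.
  by rewrite !mul0r sub0r => /esym/eqP; rewrite oppr_eq0 => /eqP.
rewrite (skm_expectation_step A b) ?gt_eqF // -/D -/S -/e gammaE.
rewrite mulrBl mul1r lerD2l lerN2.
have -> : q%:R * 'C(m, q)%:R * sig ^+ 2 / (N / D * m%:R * S) * norm2 e ^+ 2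
    = (sig ^+ 2 * norm2 e ^+ 2) / g * (D / S).
  have -> : N = q%:R * 'C(m, q)%:R * g / m%:R.
    by rewrite -NE mulrC mulKf ?gt_eqF.
  have q0 : q%:R != 0 :> R by rewrite pnatr_eq0 -lt0n.
  have C0 : 'C(m, q)%:R != 0 :> R by rewrite pnatr_eq0 -lt0n bin_gt0.
  by field; rewrite q0 C0 !gt_eqF.
(* By [sig_le] the factor in front of [D / S] is at most 1. *)
by rewrite ler_piMl ?divr_ge0 ?(ltW S_gt0) // ler_pdivrMr // mul1r.
Qed.
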